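(* Fix $\lambda>0$ and suppose some kernel $P_{Y^*|X}$ attains the infimum $F(\lambda)=\inf_{P_{Y|X}}\{I(X;Y)+\lambda\mathbb E[\mathsf d(X,Y)]\}$, with output distribution $P_{Y^*}$. Let $P_{Y_0}$ satisfy $D(P_{Y^*}\|P_{Y_0})<\infty$ and run the generalized Blahut iteration from $P_{Y_0}$. Then $(F_k(\lambda))_{k\ge1}$ is non-increasing, converges to $F(\lambda)$, and for every $k\ge1$ $$F_k(\lambda)-F(\lambda)\le\frac{D(P_{Y^*}\|P_{Y_0})}{k}.$$
   Context: $X$ has law $P_X$ on a measurable space $\mathcal X$; $\mathsf d\colon\mathcal X\times\mathcal Y\to[0,\infty)$ is a measurable distortion measure (all $\sigma$-algebras containing singletons). Generalized Blahut iteration: given a probability measure $P_{Y_0}$ on $\mathcal Y$, for $k=1,2,\dots$ set $\Sigma_{k-1}(x)=\mathbb E[\exp(-\lambda\mathsf d(x,Y_{k-1}))]$ with $Y_{k-1}\sim P_{Y_{k-1}}$; define the kernel $P_{Y_k|X}$ by $\frac{dP_{Y_k|X=x}}{dP_{Y_{k-1}}}(y)=\frac{\exp(-\lambda\mathsf d(x,y))}{\Sigma_{k-1}(x)}$; this kernel attains $F_k(\lambda)=\min_{P_{Y|X}}\{D(P_{Y|X}\|P_{Y_{k-1}}|P_X)+\lambda\mathbb E[\mathsf d(X,Y)]\}=\mathbb E[\log\frac1{\Sigma_{k-1}(X)}]$; and let $P_{Y_k}$ be the $\mathcal Y$-marginal of $P_XP_{Y_k|X}$. Here $D(P_{Y|X}\|Q|P_X)=\int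 D(P_{Y|X=x}\|Q)\,dP_X(x)$ is conditional relative entropy. Logarithms natural. *)

(* Defs.v *)
From HB Require Import structures.
From mathcomp Require Import all_boot all_order all_algebra.
From mathcomp Require Import all_classical all_reals all_analysis.
Set Implicit Arguments. Unset Strict Implicit. Unset Printing Implicit Defensive.
Import Order.TTheory GRing.Theory Num.Theory.
Import numFieldNormedType.Exports.
Local Open Scope classical_set_scope.
Local Open Scope ring_scope.
Local Open Scope ereal_scope.

(* All "measures" below are handled as set functions [set T -> \bar R];
   integrals [\int[mu]] in MathComp-Analysis are defined for any such set
   function, and every set function to which we apply them is (mathematically)
   a measure. *)

Section info.
Context {R : realType}.

Definition is_density {d} {T : measurableType d}
    (P Q : set T -> \bar R) (f : T -> R) : Prop :=
  [/\ measurable_fun [set: T] f, (forall x, 0 <= f x)%R &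
      forall A, measurable A -> P A = \int[Q]_(x in A) (f x)%:E].

Definition relent {d} {T : measurableType d} (P Q : set T -> \bar R) : \bar R :=
  match pselect (exists f, is_density P Q f) with
  | left h => let f := proj1_sig (cid h) in
              \int[Q]_x ((f x * ln (f x))%R)%:E
  | right _ => +oo
  end.

Context {dx dy : measure_display} {TX : measurableType dx} {TY : measurableType dy}.

Definition condrelent (PX : set TX -> \bar R) (K : R.-pker TX ~> TY)
    (Q : set TY -> \bar R) : \bar R :=
  \int[PX]_x relent (K x) Q.

Definition marginal (PX : set TX -> \bar R) (K : R.-pker TX ~> TY) :
    set TY -> \bar R := fun B => \int[PX]_x K x B.

Definition mutinf (PX : set TX -> \bar R) (K : R.-pker TX ~> TY) : \bar R :=
  condrelent PX K (marginal PX K).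

Definition exp_distortion (PX : set TX -> \bar R) (dist : TX -> TY -> R)
    (K : R.-pker TX ~> TY) : \bar R :=
  \int[PX]_x \int[K x]_y (dist x y)%:E.

Definition RDF (PX : set TX -> \bar R) (dist : TX -> TY -> R) (lam : R) : \bar R :=
  ereal_inf [set mutinf PX K + lam%:E * exp_distortion PX dist K
            | K in [set: R.-pker TX ~> TY]].

Definition Sigma (dist : TX -> TY -> R) (lam : R) (Q : set TY -> \bar R)
    (x : TX) : \bar R :=
  \int[Q]_y (expR (- (lam * dist x y)))%:E.

(* one step of the generalized Blahut iteration: the Y-marginal of P_X P_{Y_k|X}
   where dP_{Y_k|X=x}/dP_{Y_{k-1}}(y) = exp(-lambda d(x,y)) / Sigma_{k-1}(x) *)
Definition blahut_step (PX : set TX -> \bar R) (dist : TX -> TY -> R) (lam : R)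
    (Q : set TY -> \bar R) : set TY -> \bar R :=
  fun B => \int[PX]_x \int[Q]_(y in B)
             (expR (- (lam * dist x y)) / fine (Sigma dist lam Q x))%:E.

Fixpoint blahut (PX : set TX -> \bar R) (dist : TX -> TY -> R) (lam : R)
    (PY0 : set TY -> \bar R) (k : nat) : set TY -> \bar R :=
  match k with
  | O => PY0
  | S k' => blahut_step PX dist lam (blahut PX dist lam PY0 k')
  end.

(* F_k(lambda) = min_{P_{Y|X}} { D(P_{Y|X} || P_{Y_{k-1}} | P_X) + lambda E[d] }
   (meaningful for k >= 1) *)
Definition Fk (PX : set TX -> \bar R) (dist : TX -> TY -> R) (lam : R)
    (PY0 : set TY -> \bar R) (k : nat) : \bar R :=
  ereal_inf [set condrelent PX K (blahut PX dist lam PY0 k.-1)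
                 + lam%:E * exp_distortion PX dist K
            | K in [set: R.-pker TX ~> TY]].

End info.

(* Main.v *)
Require Import Defs.
From HB Require Import structures.
From mathcomp Require Import all_boot all_order all_algebra.
From mathcomp Require Import all_classical all_reals all_analysis.
From mathcomp Require Import measurable_realfun ring lra.
Set Implicit Arguments. Unset Strict Implicit. Unset Printing Implicit Defensive.
Import Order.TTheory GRing.Theory Num.Theory.
Import numFieldNormedType.Exports.
Local Open Scope classical_set_scope.
Local Open Scope ring_scope.
Local Open Scope ereal_scope.

(** Write Q for the current output law, Q' for the next one, Ps for the optimal
    output law, Z(x) for the integral of exp(-lambda d(x,y)) dQ(y), and c = dQ'/dQ,
    which is the P_X-average of the tilts exp(-lambda d(x,y)) / Z(x).

    The Donsker-Varadhan bound gives F_k = E[-ln Z(X)], attained by the tilted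
    kernel. Replacing Q by the marginal Q' of that kernel only decreases its
    conditional relative entropy, so F_{k+1} <= F_k and F <= F_k.

    For the rate, the Donsker-Varadhan bound for D(P_{Ystar|X=x} || Ps) with test
    function ln (exp(-lambda d(x,y)) / (Z(x) c(y))), averaged over x, reads
    F >= F_k - E_{Ps}[ln c], and E_{Ps}[ln c] = D(Ps||Q) - D(Ps||Q'). Telescoping
    finishes the proof.

    Relative entropies are written as integrals of t ln t - t + 1 >= 0 and ln c is
    split into its positive and negative parts, so that all integrands are
    nonnegative and no integrability has to be known in advance. *)

(** * Lower integrals of nonnegative functions *)

(* [relent (K x) Q] need not be measurable in [x] when the sigma-algebra of the
   output space is not countably generated.  The integral of a nonnegative
   function is then the supremum over the simple functions below it, which is
   monotone and satisfies the following half of additivity. *)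
Section lower_integral.
Context d (T : measurableType d) (R : realType).
Variable mu : {measure set T -> \bar R}.
Implicit Types f g h : T -> \bar R.

Lemma le_lower_integral f g : (forall x, 0 <= f x) -> (forall x, f x <= g x) ->
  \int[mu]_x f x <= \int[mu]_x g x.
Proof.
move=> f0 fg; rewrite !ge0_integralTE//; last first.
  by move=> x; exact: le_trans (fg x).
apply: ge_ereal_sup => _ [s /= sf <-]; apply: ereal_sup_ubound.
by exists s => //= x; exact: le_trans (fg x).
Qed.

Lemma lower_integralD_ge f g h :
    (forall x, 0 <= f x) -> (forall x, 0 <= g x) -> (forall x, 0 <= h x) ->
    measurable_fun [set: T] g -> measurable_fun [set: T] h ->
    (forall x, h x <= f x + g x) ->
  \int[mu]_x h x <= \int[mu]_x f x + \int[mu]_x g x.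
Proof.
move=> f0 g0 h0 mg mh hfg.
(* The positive part of [h - g] is measurable and lies below [f], so additivity is applied to
   [u + g], which dominates [h] even where [g] is infinite. *)
pose u x := maxe (h x - g x) 0.
have u0 x : 0 <= u x by rewrite le_max lexx orbT.
have mu' : measurable_fun [set: T] u.
  by apply: measurable_maxe => //; exact: emeasurable_funB.
have uf x : u x <= f x.
  rewrite ge_max f0 andbT; have := g0 x; have := hfg x.
  case: (g x) => [r hfr _| _ _|//]; first by rewrite leeBlDr.
  by rewrite /= addeNy leNye.
have hug x : h x <= u x + g x.
  have := g0 x; case gx : (g x) => [r| |] //= r0.
    by rewrite -leeBlDr// le_max gx lexx.
  by rewrite addey ?leey// gt_eqF// (lt_le_trans _ (u0 x)).
apply: (@le_trans _ _ (\int[mu]_x (u x + g x))).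
  by apply: ge0_le_integral => //; exact: emeasurable_funD.
by rewrite ge0_integralD// leeD2r// le_lower_integral.
Qed.

End lower_integral.

(** * Densities and change of measure *)

Section density.
Context d (T : measurableType d) (R : realType).
Implicit Types (P Q : probability T R) (f g : T -> R).

Lemma is_density_dominates P Q f : is_density P Q f -> P `<< Q.
Proof.
move=> [mf f0 Pf]; apply/null_content_dominatesP => A mA QA.
rewrite Pf//; apply: null_set_integral => //.
  by apply: measurable_funTS; exact/measurable_EFinP.
Qed.

Lemma is_density_integrable P Q f : is_density P Q f ->
  Q.-integrable [set: T] (EFin \o f).
Proof.
move=> [mf f0 Pf]; apply/integrableP; split; first exact/measurable_EFinP.
under eq_integral do rewrite /= ger0_norm//.
by rewrite -Pf// probability_setT ltry.
Qed.

Lemma is_density_ae_eq P Q f g : is_density P Q f -> is_density P Q g ->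
  ae_eq Q [set: T] (EFin \o f) (EFin \o g).
Proof.
move=> Pf [mg g0 Pg]; apply: integral_ae_eq => //.
- exact: is_density_integrable Pf.
- exact/measurable_EFinP.
- by case: Pf => mf f0 Pf A _ mA; rewrite -Pf// -Pg.
Qed.

(** The change of variables holds for the Radon-Nikodym derivative, and [f] agrees with it
    [Q]-almost everywhere because both have the same integral over every measurable set. *)
Lemma is_density_integral P Q f (g : T -> \bar R) : is_density P Q f ->
  measurable_fun [set: T] g -> (forall x, 0 <= g x) ->
  \int[P]_x g x = \int[Q]_x (g x * (f x)%:E).
Proof.
move=> Pf mg g0; have PQ := is_density_dominates Pf.
rewrite -(Radon_Nikodym_SigmaFinite.change_of_variables PQ)//.
have mrn := measurable_int _ (Radon_Nikodym_SigmaFinite.f_integrable PQ).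
case: (Pf) => mf f0 Pf'.
apply: ae_eq_integral => //.
- exact: emeasurable_funM.
- by apply: emeasurable_funM => //; exact/measurable_EFinP.
- apply: ae_eqe_mul2l; apply: ae_eq_sym; apply: integral_ae_eq => //.
  + exact: is_density_integrable Pf.
  + by move=> A _ mA; rewrite -Radon_Nikodym_SigmaFinite.f_integral// -Pf'.
Qed.

End density.

(** * Relative entropy and its variational bound *)

Section relative_entropy.
Context d (T : measurableType d) (R : realType).
Implicit Types (P Q : probability T R) (f g a b e : T -> R).

Lemma measurable_fun_gt0_inv f : measurable_fun [set: T] f ->
  (forall x, 0 < f x)%R -> measurable_fun [set: T] (fun x => (f x)^-1)%R.
Proof.
move=> mf f0; rewrite (_ : (fun _ => _) = (fun x => expR (- ln (f x)))).
  apply: measurableT_comp => //; apply: measurableT_comp => //.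
  exact: measurableT_comp (@measurable_ln R) mf.
by apply/funext => x; rewrite expRN lnK ?posrE.
Qed.

(** It differs from [t * ln t] by [1 - t], whose integral vanishes when [t] is a probability
    density. *)
Definition phi (t : R) : R := (t * ln t - t + 1)%R.

(** This is the Fenchel-Young inequality for the conjugate pair [u * ln u - u] and [expR v]; for
    [u > 0] it is [1 + w <= expR w] at [w = v - ln u], multiplied by [u]. *)
Lemma mul_ln_ge (u v : R) : (0 <= u)%R -> (u * v - expR v <= u * ln u - u)%R.
Proof.
rewrite le_eqVlt => /predU1P[<-|u0].
  by rewrite !mul0r !sub0r oppr0 oppr_le0 expR_ge0.
have := expR_ge1Dx (v - ln u); rewrite expRD expRN lnK ?posrE//.
rewrite ler_pdivlMr// => h; lra.
Qed.

Lemma phi_ge0 u : (0 <= u)%R -> (0 <= phi u)%R.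
Proof.
by move=> u0; have := mul_ln_ge 0 u0; rewrite /phi mulr0 expR0 => h; lra.
Qed.

Lemma measurable_phi : measurable_fun [set: R] phi.
Proof.
apply: measurable_funD => //; apply: measurable_funB => //.
by apply: measurable_funM => //; exact: measurable_ln.
Qed.

Lemma ge0_integralD_EFin (mu : {measure set T -> \bar R}) f g :
  measurable_fun [set: T] f -> measurable_fun [set: T] g ->
  (forall x, 0 <= f x)%R -> (forall x, 0 <= g x)%R ->
  \int[mu]_x (f x + g x)%:E = \int[mu]_x (f x)%:E + \int[mu]_x (g x)%:E.
Proof.
move=> mf mg f0 g0; rewrite -ge0_integralD//; try exact/measurable_EFinP.
- by move=> x _; rewrite lee_fin.
- by move=> x _; rewrite lee_fin.
Qed.

Lemma is_density_integral_EFin P Q f g : is_density P Q f ->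
  measurable_fun [set: T] g -> (forall x, 0 <= g x)%R ->
  \int[P]_x (g x)%:E = \int[Q]_x (g x * f x)%:E.
Proof.
move=> Pf mg g0; rewrite (is_density_integral Pf)//; exact/measurable_EFinP.
Qed.

Lemma is_density_integral1 P Q f : is_density P Q f -> \int[Q]_x (f x)%:E = 1.
Proof. by case=> _ _ /(_ setT measurableT) <-; exact: probability_setT. Qed.

Lemma probability_integral_cst P (r : R) : \int[P]_x r%:E = r%:E.
Proof. by rewrite integral_cst// [X in _ * X]probability_setT mule1. Qed.

Lemma relentE P Q f : is_density P Q f ->
  relent P Q = \int[Q]_x (phi (f x))%:E.
Proof.
move=> Pf; have [mf f0 _] := Pf.
rewrite /relent; case: pselect => [h|]; last by case; exists f.
case: cid => g Pg /=; have [mg g0 _] := Pg.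
have mphi : measurable_fun [set: T] (phi \o f).
  exact: measurableT_comp measurable_phi mf.
have mxlnx (u : T -> R) : measurable_fun [set: T] u ->
    measurable_fun [set: T] (fun x => u x * ln (u x))%R.
  move=> mu; apply: measurable_funM => //.
  exact: measurableT_comp (@measurable_ln R) mu.
(* The density [g] picked by choice in [relent] differs from [f] only on a [Q]-null set. *)
have -> : \int[Q]_x (g x * ln (g x))%:E = \int[Q]_x (f x * ln (f x))%:E.
  apply: ae_eq_integral => //.
  - exact/measurable_EFinP/mxlnx.
  - exact/measurable_EFinP/mxlnx.
  - have := is_density_ae_eq Pg Pf; apply: filterS => x /= /(_ I) [gf] _.
    by rewrite gf.
pose p x := Num.max (f x * ln (f x))%R 0%R.
pose n x := Num.max (- (f x * ln (f x)))%R 0%R.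
have p0 x : (0 <= p x)%R by rewrite le_max lexx orbT.
have n0 x : (0 <= n x)%R by rewrite le_max lexx orbT.
have mp : measurable_fun [set: T] p.
  by apply: measurable_maxr => //; exact: mxlnx.
have mn : measurable_fun [set: T] n.
  by apply: measurable_maxr => //; apply: measurableT_comp => //; exact: mxlnx.
(* Nonnegativity of [phi] gives [- (t * ln t) <= 1 - t <= 1], so the negative part has a finite
   integral and can be subtracted. *)
have n1 x : (n x <= 1)%R.
  rewrite ge_max ler01 andbT.
  by have := f0 x; have := phi_ge0 (f0 x); rewrite /phi; lra.
have nfin : \int[Q]_x (n x)%:E \is a fin_num.
  rewrite ge0_fin_numE; last by apply: integral_ge0 => x _; rewrite lee_fin.
  apply: (@le_lt_trans _ _ (\int[Q]_x (1%R)%:E)); last first.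
    by rewrite probability_integral_cst ltry.
  apply: ge0_le_integral => //; last by move=> x _; rewrite lee_fin.
  - by move=> x _; rewrite lee_fin.
  - exact/measurable_EFinP.
have -> : \int[Q]_x (f x * ln (f x))%:E = \int[Q]_x (p x)%:E - \int[Q]_x (n x)%:E.
  by rewrite integralE; congr (_ - _); apply: eq_integral => x _;
    rewrite ?funeposE ?funenegE ?EFin_max ?EFinN.
(* Pointwise, [phi f + f + n = p + 1], where both [f] and [1] integrate to one. *)
have H : \int[Q]_x (phi (f x))%:E + 1 + \int[Q]_x (n x)%:E =
         \int[Q]_x (p x)%:E + 1.
  rewrite -[in LHS](is_density_integral1 Pf) -[X in _ = _ + X](probability_integral_cst Q 1).
  rewrite -!ge0_integralD_EFin//.
  - apply: eq_integral => x _; congr (_%:E); rewrite /phi /p /n /=.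
    by case: (leP (f x * ln (f x)) 0)%R; case: (leP (- (f x * ln (f x))) 0)%R; lra.
  - exact: measurable_funD.
  - by move=> x; rewrite addr_ge0// phi_ge0.
  - by move=> x; exact: phi_ge0.
move: nfin H; case: (\int[Q]_x (n x)%:E) => [n'| |]// _.
case: (\int[Q]_x (phi (f x))%:E) => [i| |]; case: (\int[Q]_x (p x)%:E) => [p'| |]//=.
by rewrite -!EFinD => -[] ?; congr (_%:E); lra.
Qed.

Lemma relent_ge0 P Q : 0 <= relent P Q.
Proof.
have [[f Pf]|nPQ] := pselect (exists f, is_density P Q f).
  rewrite (relentE Pf); case: Pf => _ f0 _.
  by apply: integral_ge0 => x _; rewrite lee_fin phi_ge0.
by rewrite /relent; case: pselect.
Qed.

Lemma relent_lty_density P Q : relent P Q < +oo -> exists f, is_density P Q f.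
Proof. by rewrite /relent; case: pselect. Qed.

Lemma relent_refl P : relent P P = 0.
Proof.
have PP : is_density P P (fun=> 1%R).
  by split=> // A mA; rewrite integral_cst// mul1e.
rewrite (relentE PP); apply: integral0_eq => x _.
by rewrite /phi ln1 mulr0 sub0r addNr.
Qed.

(* The Donsker-Varadhan bound with test function [b - a], linearised
   ([ln t <= t - 1]) and rearranged so that every integrand is nonnegative. *)
Lemma relent_variational P Q a b e :
  measurable_fun [set: T] a -> measurable_fun [set: T] b ->
  measurable_fun [set: T] e ->
  (forall x, 0 <= a x)%R -> (forall x, 0 <= b x)%R ->
  (forall x, expR (b x - a x) <= e x)%R ->
  \int[P]_x (b x)%:E + 1 <=
    relent P Q + (\int[Q]_x (e x)%:E + \int[P]_x (a x)%:E).
Proof.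
move=> ma mb me a0 b0 abe.
have e0 x : (0 <= e x)%R by apply: le_trans (abe x); exact: expR_ge0.
have [[f Pf]|nPQ] := pselect (exists f, is_density P Q f); last first.
  rewrite {1}/relent; case: pselect => // _; rewrite addye ?leey//.
  by rewrite gt_eqF// (@lt_le_trans _ _ 0)// adde_ge0//;
    apply: integral_ge0 => x _; rewrite lee_fin.
rewrite (relentE Pf) !(is_density_integral_EFin Pf)//.
have [mf f0 _] := Pf.
have mphi : measurable_fun [set: T] (phi \o f).
  exact: measurableT_comp measurable_phi mf.
have maf : measurable_fun [set: T] (fun x => a x * f x)%R by exact: measurable_funM.
have mbf : measurable_fun [set: T] (fun x => b x * f x)%R by exact: measurable_funM.
have af0 x : (0 <= a x * f x)%R by rewrite mulr_ge0.
have bf0 x : (0 <= b x * f x)%R by rewrite mulr_ge0.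
have ef0 x : (0 <= e x + a x * f x)%R by rewrite addr_ge0.
have pf0 x : (0 <= (phi \o f) x)%R by exact: phi_ge0.
rewrite -[X in _ + X <= _](probability_integral_cst Q 1).
rewrite -!ge0_integralD_EFin//; last exact: measurable_funD.
apply: ge0_le_integral => //.
- by move=> x _; rewrite lee_fin addr_ge0.
- by apply/measurable_EFinP; exact: measurable_funD.
- apply/measurable_EFinP; apply: measurable_funD => //.
  exact: measurable_funD.
- move=> x _; rewrite lee_fin /= /phi.
  (* Fenchel-Young at the density [f x] and exponent [b x - a x] gives the inequality between the
     integrands. *)
  have := mul_ln_ge (b x - a x) (f0 x); have := abe x; lra.
Qed.

Definition lnpos (c : R) : R := Num.max (ln c) 0%R.
Definition lnneg (c : R) : R := Num.max (- ln c)%R 0%R.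

Lemma lnpos_ge0 c : (0 <= lnpos c)%R. Proof. by rewrite le_max lexx orbT. Qed.

Lemma lnneg_ge0 c : (0 <= lnneg c)%R. Proof. by rewrite le_max lexx orbT. Qed.

Lemma lnposBneg c : (lnpos c - lnneg c = ln c)%R.
Proof.
rewrite /lnpos /lnneg.
by case: (leP (ln c) 0)%R; case: (leP (- ln c) 0)%R; lra.
Qed.

Lemma measurable_lnpos : measurable_fun [set: R] lnpos.
Proof. by apply: measurable_maxr => //; exact: measurable_ln. Qed.

Lemma measurable_lnneg : measurable_fun [set: R] lnneg.
Proof.
by apply: measurable_maxr => //; exact: measurableT_comp (@measurable_ln R).
Qed.

(** * Change of the reference measure *)

Section chain_rule.
Variables (P Q Q' : probability T R) (h c : T -> R).
Hypotheses (Ph : is_density P Q h) (Qc : is_density Q' Q c).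
Hypothesis c_gt0 : forall x, (0 < c x)%R.

Lemma is_density_div : is_density P Q' (fun x => h x / c x)%R.
Proof.
have [[mh h0 PhE] [mc c0 _]] := (Ph, Qc).
have mhc : measurable_fun [set: T] (fun x => h x / c x)%R.
  by apply: measurable_funM => //; exact: measurable_fun_gt0_inv.
split => //; first by move=> x; rewrite divr_ge0.
move=> A mA; rewrite integral_mkcond.
rewrite (is_density_integral Qc).
- rewrite PhE// integral_mkcond; apply: eq_integral => x _.
  rewrite !patchE; case: ifPn => _; last by rewrite mul0e.
  by rewrite -EFinM divfK// gt_eqF.
- by apply/(measurable_restrictT _ mA).1/measurable_funTS/measurable_EFinP.
- by move=> x; rewrite erestrict_ge0// => y _; rewrite lee_fin divr_ge0.
Qed.

(** Since dP/dQ' = h / c, this is D(P||Q') + E_P[ln c] = D(P||Q), with the negative part of ln c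
    moved to the right so that infinite terms are harmless. *)
Lemma relent_chain_rule :
  relent P Q' + \int[P]_x (lnpos (c x))%:E =
  relent P Q + \int[P]_x (lnneg (c x))%:E.
Proof.
have [[mh h0 PhE] [mc c0 _]] := (Ph, Qc).
have mp : measurable_fun [set: T] (lnpos \o c).
  exact: measurableT_comp measurable_lnpos mc.
have mn : measurable_fun [set: T] (lnneg \o c).
  exact: measurableT_comp measurable_lnneg mc.
have mphi (f : T -> R) : measurable_fun [set: T] f -> measurable_fun [set: T] (phi \o f).
  by move=> mf; exact: measurableT_comp measurable_phi mf.
have [mhc hc0 _] := is_density_div.
rewrite (relentE is_density_div) (relentE Ph).
rewrite !(is_density_integral_EFin Ph)//; [|by move=> x; exact: lnneg_ge0
  |by move=> x; exact: lnpos_ge0].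
rewrite (is_density_integral_EFin Qc); [|exact: mphi|by move=> x; exact: phi_ge0].
(* A one is added to each side, as the integral of [1] on the left and of [c] on the right; the
   integrands then agree pointwise. *)
rewrite -[LHS](@addeK R 1)// -[RHS](@addeK R 1)//; congr (_ - _).
rewrite -[X in _ + X = _](probability_integral_cst Q 1).
rewrite -[X in _ = _ + X](is_density_integral1 Qc).
have mhp : measurable_fun [set: T] (fun x => lnpos (c x) * h x)%R.
  exact: measurable_funM.
have mhn : measurable_fun [set: T] (fun x => lnneg (c x) * h x)%R.
  exact: measurable_funM.
have hp0 x : (0 <= lnpos (c x) * h x)%R by rewrite mulr_ge0// lnpos_ge0.
have hn0 x : (0 <= lnneg (c x) * h x)%R by rewrite mulr_ge0// lnneg_ge0.
have mf1 : measurable_fun [set: T] (fun x => phi (h x / c x) * c x)%R.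
  by apply: measurable_funM => //; exact: mphi.
have f10 x : (0 <= phi (h x / c x) * c x)%R by rewrite mulr_ge0// phi_ge0.
have mf2 : measurable_fun [set: T] (phi \o h) by exact: mphi.
have f20 x : (0 <= phi (h x))%R by rewrite phi_ge0.
rewrite -!ge0_integralD_EFin//; try exact: measurable_funD;
  try by move=> x; rewrite addr_ge0.
apply: eq_integral => x _; congr (_%:E); rewrite /phi.
have := lnposBneg (c x) => lnc; have cx := c_gt0 x.
(* The logarithm of [h / c] splits only where [h > 0]; points with [h = 0] are checked directly. *)
have := h0 x; rewrite le_eqVlt => /predU1P[<-|hx].
  by rewrite !(mul0r, mulr0, subr0, add0r) mul1r; lra.
rewrite ln_div ?posrE// -lnc.
have cN : c x != 0%R by rewrite gt_eqF.
by field.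
Qed.

(** The variational bound with test function ln^+ c applies because its exponential max(c, 1) is at
    most c + 1, which has [Q]-integral two. It makes E_P[ln^+ c] finite as soon as D(P||Q) is. *)
Lemma relent_lnpos_le : \int[P]_x (lnpos (c x))%:E <= relent P Q + 1.
Proof.
have [[mh h0 PhE] [mc c0 _]] := (Ph, Qc).
have mp : measurable_fun [set: T] (lnpos \o c).
  exact: measurableT_comp measurable_lnpos mc.
have := @relent_variational P Q (fun=> 0%R) (lnpos \o c) (fun x => c x + 1)%R.
have m1 : measurable_fun [set: T] (fun x => c x + 1)%R by exact: measurable_funD.
move/(_ (measurable_cst _) mp m1 (fun=> lexx _) (fun x => lnpos_ge0 (c x))).
rewrite ge0_integralD_EFin// (is_density_integral1 Qc) !probability_integral_cst.
rewrite adde0 addeA leeD2rE//; apply => x /=.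
rewrite subr0 /lnpos; case: (leP (ln (c x)) 0)%R => _.
  by rewrite expR0 lerDr.
by rewrite lnK ?posrE// lerDl.
Qed.

End chain_rule.

End relative_entropy.

(** * Set functions as probability measures; kernels and marginals *)

Lemma probability_pack (R : realType) d (T : measurableType d)
    (mu : set T -> \bar R) :
    mu set0 = 0 -> (forall A, 0 <= mu A) -> semi_sigma_additive mu ->
    mu setT = 1 ->
  exists P : probability T R, P = mu :> (set T -> \bar R).
Proof.
move=> mu0 mu_ge0 mu_sigma muT.
pose m : {measure set T -> \bar R} :=
  HB.pack mu (isMeasure.Build _ _ _ mu mu0 mu_ge0 mu_sigma).
pose P : probability T R := HB.pack mu (Measure.on m) (Measure_isProbability.Build _ _ _ m muT).
by exists P.
Qed.

Section kernels.
Context (R : realType) d (T : measurableType d) d' (T' : measurableType d').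

Lemma pker_probability (K : R.-pker T ~> T') x :
  exists P : probability T' R, P = K x :> (set T' -> \bar R).
Proof.
apply: probability_pack => //; first exact: measure_semi_sigma_additive.
exact: prob_kernel.
Qed.

Lemma density_kernel (Q : probability T' R) (f : T -> T' -> R) :
    measurable_fun [set: T * T'] (fun p => f p.1 p.2) ->
    (forall x y, 0 <= f x y)%R ->
    (forall x, \int[Q]_y (f x y)%:E = 1) ->
  exists K : R.-pker T ~> T',
    forall x, K x = (fun B => \int[Q]_(y in B) (f x y)%:E) :> (set T' -> \bar R).
Proof.
move=> mf f0 f1.
have mfx x : measurable_fun [set: T'] (fun y => (f x y)%:E).
  by apply/measurable_EFinP; exact: (measurableT_comp mf (pair1_measurable x)).
pose k x (B : set T') := \int[Q]_(y in B) (f x y)%:E.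
have k0 x : k x set0 = 0 by rewrite /k integral_set0.
have k_ge0 x B : 0 <= k x B by apply: integral_ge0 => y _; rewrite lee_fin.
have k_sigma x : semi_sigma_additive (k x).
  by apply: semi_sigma_additive_nng_induced => // y; rewrite lee_fin.
pose km x : {measure set T' -> \bar R} :=
  HB.pack (k x) (isMeasure.Build _ _ _ (k x) (k0 x) (k_ge0 x) (k_sigma x)).
have mk U : measurable U -> measurable_fun [set: T] (km ^~ U).
  (* Restriction to [U] becomes multiplication by its indicator, so that Tonelli gives measurability
     in [x]. *)
  move=> mU; rewrite (_ : (fun _ => _) =
      fun x => \int[Q]_y (f x y * \1_U y)%:E); last first.
    apply/funext => x; rewrite /= /k integral_mkcond; apply: eq_integral => y _.
    by rewrite patchE indicE; case: ifPn => _ /=; rewrite ?mulr1 ?mulr0.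
  pose g (p : T * T') := (f p.1 p.2 * \1_U p.2)%:E.
  apply: (@measurable_fun_fubini_tonelli_F _ _ _ _ _ Q g).
  - apply/measurable_EFinP/measurable_funM => //.
    by apply: (measurableT_comp (measurable_indic mU)).
  - by move=> p; rewrite lee_fin mulr_ge0.
pose kk : R.-ker T ~> T' := HB.pack km (isKernel.Build _ _ _ _ _ km mk).
pose K : R.-pker T ~> T' := HB.pack km (Kernel.on kk)
  (Kernel_isProbability.Build _ _ _ _ _ kk f1).
by exists K.
Qed.

Variables (PX : probability T R) (K : R.-pker T ~> T').

(** With [PX] viewed as a kernel from the one-point space, the marginal becomes a composition of
    kernels evaluated at [tt]. *)
Let l : R.-pker unit ~> T :=
  kprobability (@measurable_cst _ _ unit _ setT (PX : pprobability T R)).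

Lemma integral_marginal (g : T' -> \bar R) : (forall y, 0 <= g y) ->
  measurable_fun [set: T'] g ->
  \int[marginal PX K]_y g y = \int[PX]_x \int[K x]_y g y.
Proof. exact: (integral_kcomp l (kernel.kernel_snd (T0:=unit) K) tt). Qed.

Lemma marginal_probability :
  exists P : probability T' R, P = marginal PX K :> (set T' -> \bar R).
Proof.
pose m := mkcomp l (kernel.kernel_snd (T0:=unit) K) tt.
apply: probability_pack.
- exact: (measure0 m).
- exact: (measure_ge0 m).
- exact: (@measure_semi_sigma_additive _ _ _ m).
- rewrite /marginal; under eq_integral do rewrite prob_kernel.
  exact: probability_integral_cst.
Qed.

End kernels.

(** A zero integral would make [f] vanish off a null set; as [f] vanishes nowhere, that null set
    would be the whole space, of mass one. *)
Lemma probability_integral_gt0 d (T : measurableType d) (R : realType)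
    (P : probability T R) (f : T -> R) :
  measurable_fun [set: T] f -> (forall x, 0 < f x)%R ->
  0 < \int[P]_x (f x)%:E.
Proof.
move=> mf f0; rewrite lt_neqAle integral_ge0 ?andbT; last first.
  by move=> x _; rewrite lee_fin ltW.
apply/negP => /eqP I0.
have /(ae_eq_integral_abs P measurableT) : measurable_fun [set: T] (EFin \o f).
  exact/measurable_EFinP.
case=> + _; case.
  by rewrite [RHS]I0; apply: eq_integral => x _; rewrite /= gtr0_norm.
move=> N [mN N0 subN]; have : P [set: T] <= P N.
  rewrite le_measure ?inE// => x _; apply: subN => /= /(_ I) [fx0].
  by have := f0 x; rewrite fx0 ltxx.
by rewrite N0 [X in X <= _]probability_setT lee_fin ler10.
Qed.

(** * One step of the iteration *)

Section blahut_step.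
Context (R : realType) (dx dy : measure_display).
Context (TX : measurableType dx) (TY : measurableType dy).
Variables (PX : probability TX R) (dist : TX -> TY -> R) (lam : R).
Hypothesis mdist : measurable_fun [set: TX * TY] (fun p => dist p.1 p.2).
Hypothesis dist_ge0 : forall x y, (0 <= dist x y)%R.
Hypothesis lam_ge0 : (0 <= lam)%R.

Lemma scale_exp_distortion (K : R.-pker TX ~> TY) :
  lam%:E * exp_distortion PX dist K =
  \int[PX]_x \int[K x]_y (lam * dist x y)%:E.
Proof.
rewrite /exp_distortion -ge0_integralZl//.
- apply: eq_integral => x _; rewrite -ge0_integralZl//.
  + by apply/measurable_EFinP; exact: (measurableT_comp mdist (pair1_measurable x)).
  + by move=> y _; rewrite lee_fin.
- pose g (p : TX * TY) := (dist p.1 p.2)%:E.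
  apply: (measurable_fun_integral_finite_kernel g K).
  + by move=> p; rewrite lee_fin.
  + exact/measurable_EFinP.
- by move=> x _; apply: integral_ge0 => y _; rewrite lee_fin.
Qed.

Let mexp : measurable_fun [set: TX * TY]
  (fun p => expR (- (lam * dist p.1 p.2)))%R.
Proof.
apply: measurableT_comp => //; apply: measurableT_comp => //.
exact: measurable_funM.
Qed.

(** * Partition function, tilted kernel and free energy *)

Section partition_function.
Variable Q : probability TY R.

(** As the distortion is nonnegative, [Sigma] lies in (0, 1]; hence [fine] loses nothing and
    [- ln (Z x)] is nonnegative. *)
Definition partfun x : R := fine (Sigma dist lam Q x).
Local Notation Z := partfun.

Lemma Sigma_le1 x : Sigma dist lam Q x <= 1.
Proof.
rewrite -[leRHS](probability_integral_cst Q 1); apply: ge0_le_integral => //.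
- by apply/measurable_EFinP; exact: (measurableT_comp mexp (pair1_measurable x)).
- by move=> y _; rewrite lee_fin expR_le1 oppr_le0 mulr_ge0.
Qed.

Lemma partfunE x : Sigma dist lam Q x = (Z x)%:E.
Proof.
rewrite /partfun fineK// ge0_fin_numE.
  exact: le_lt_trans (Sigma_le1 x) (ltry _).
by apply: integral_ge0 => y _; rewrite lee_fin expR_ge0.
Qed.

Lemma partfun_gt0 x : (0 < Z x)%R.
Proof.
rewrite -lte_fin -partfunE; apply: probability_integral_gt0.
  exact: (measurableT_comp mexp (pair1_measurable x)).
by move=> y; exact: expR_gt0.
Qed.

Lemma partfun_le1 x : (Z x <= 1)%R.
Proof. by rewrite -lee_fin -partfunE Sigma_le1. Qed.

Lemma measurable_partfun : measurable_fun [set: TX] Z.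
Proof.
apply: measurableT_comp => //.
pose g (p : TX * TY) := (expR (- (lam * dist p.1 p.2)))%:E.
apply: (@measurable_fun_fubini_tonelli_F _ _ _ _ _ Q g).
- exact/measurable_EFinP.
- by move=> p; rewrite lee_fin expR_ge0.
Qed.

Definition tilt x y : R := (expR (- (lam * dist x y)) / Z x)%R.

Lemma tilt_gt0 x y : (0 < tilt x y)%R.
Proof. by rewrite divr_gt0 ?expR_gt0 ?partfun_gt0. Qed.

Lemma tilt_ge0 x y : (0 <= tilt x y)%R. Proof. exact/ltW/tilt_gt0. Qed.

Lemma ln_tilt x y : ln (tilt x y) = (- (lam * dist x y) - ln (Z x))%R.
Proof. by rewrite ln_div ?posrE ?expR_gt0 ?partfun_gt0// expRK. Qed.

Lemma measurable_tilt : measurable_fun [set: TX * TY] (fun p => tilt p.1 p.2).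
Proof.
apply: measurable_funM => //.
apply: measurable_fun_gt0_inv; last by move=> p; exact: partfun_gt0.
exact: measurableT_comp measurable_partfun _.
Qed.

Lemma measurable_tilt1 x : measurable_fun [set: TY] (tilt x).
Proof. exact: (measurableT_comp measurable_tilt (pair1_measurable x)). Qed.

Lemma measurable_tilt2 y : measurable_fun [set: TX] (tilt ^~ y).
Proof. exact: (measurableT_comp measurable_tilt (pair2_measurable y)). Qed.

Lemma integral_tilt x : \int[Q]_y (tilt x y)%:E = 1.
Proof.
under eq_integral do rewrite EFinM muleC.
rewrite ge0_integralZl//.
- rewrite -/(Sigma dist lam Q x) partfunE -EFinM mulVf// gt_eqF//.
  exact: partfun_gt0.
- by apply/measurable_EFinP; exact: (measurableT_comp mexp (pair1_measurable x)).
- by rewrite lee_fin invr_ge0 ltW// partfun_gt0.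
Qed.

(** The closed form E[log 1/Sigma(X)] of the minimum defining F_k. *)
Definition free_energy : \bar R := \int[PX]_x (- ln (Z x))%:E.

Lemma oppr_ln_partfun_ge0 x : (0 <= - ln (Z x))%R.
Proof. by rewrite oppr_ge0 ln_le0// partfun_le1. Qed.

Lemma measurable_ln_partfun : measurable_fun [set: TX] (fun x => - ln (Z x))%R.
Proof.
apply: measurableT_comp => //.
exact: measurableT_comp (@measurable_ln R) measurable_partfun.
Qed.

Lemma measurable_fun_pker_distortion (K : R.-pker TX ~> TY) :
  measurable_fun [set: TX] (fun x => \int[K x]_y (lam * dist x y)%:E).
Proof.
pose g (p : TX * TY) := (lam * dist p.1 p.2)%:E.
apply: (measurable_fun_integral_finite_kernel g K).
- by move=> p; rewrite lee_fin mulr_ge0.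
- exact/measurable_EFinP/measurable_funM.
Qed.

Lemma measurable_lam_dist x : measurable_fun [set: TY] (fun y => lam * dist x y)%R.
Proof.
apply: measurable_funM => //.
exact: (measurableT_comp mdist (pair1_measurable x)).
Qed.

(** The variational bound is used at each [x] with [a = lam * dist x y], [b = - ln (Z x)] and
    [e = tilt x], which integrates to one. The bounds are integrated through [lower_integralD_ge],
    since [K] is arbitrary. *)
Lemma free_energy_le (K : R.-pker TX ~> TY) :
  free_energy <= condrelent PX K Q + lam%:E * exp_distortion PX dist K.
Proof.
rewrite scale_exp_distortion; apply: lower_integralD_ge.
- by move=> x; have [P <-] := pker_probability K x; exact: relent_ge0.
- by move=> x; apply: integral_ge0 => y _; rewrite lee_fin mulr_ge0.
- by move=> x; rewrite lee_fin oppr_ln_partfun_ge0.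
- exact: measurable_fun_pker_distortion.
- exact/measurable_EFinP/measurable_ln_partfun.
- move=> x; have [P <-] := pker_probability K x.
  have := @relent_variational _ _ _ P Q (fun y => lam * dist x y)%R
    (fun=> - ln (Z x))%R (tilt x) (measurable_lam_dist x) (measurable_cst _)
    (measurable_tilt1 x) (fun y => mulr_ge0 lam_ge0 (dist_ge0 x y))
    (fun=> oppr_ln_partfun_ge0 x).
  rewrite probability_integral_cst integral_tilt (addeC 1) addeA.
  rewrite leeD2rE//; apply => y.
  by rewrite addrC -ln_tilt lnK ?posrE ?tilt_gt0.
Qed.

Lemma blahut_kernel : exists K : R.-pker TX ~> TY,
  (forall x, K x = (fun B => \int[Q]_(y in B) (tilt x y)%:E)
    :> (set TY -> \bar R)) /\
  marginal PX K = blahut_step PX dist lam Q.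
Proof.
have [K KE] := density_kernel measurable_tilt tilt_ge0 integral_tilt.
exists K; split => //; apply/funext => B.
by apply: eq_integral => x _; rewrite KE.
Qed.

(* The density is only almost everywhere the [PX]-average of the tilts: where
   that average is infinite, it is replaced by [1]. *)
Lemma blahut_density (Q' : probability TY R) :
    Q' = blahut_step PX dist lam Q :> (set TY -> \bar R) ->
  exists c : TY -> R, [/\ is_density Q' Q c, (forall y, 0 < c y)%R &
    {ae Q, forall y, \int[PX]_x (tilt x y)%:E = (c y)%:E}].
Proof.
move=> Q'E.
pose g (p : TX * TY) := (tilt p.1 p.2)%:E.
have mg : measurable_fun [set: TX * TY] g.
  by apply/measurable_EFinP; exact: measurable_tilt.
have g0 p : 0 <= g p by rewrite lee_fin tilt_ge0.
pose c0 y := \int[PX]_x (tilt x y)%:E.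
have mc0 : measurable_fun [set: TY] c0.
  exact: (@measurable_fun_fubini_tonelli_G _ _ _ _ _ PX g).
have c0_ge0 y : 0 <= c0 y by apply: integral_ge0 => x _; exact: (g0 (x, y)).
have c0_gt0 y : 0 < c0 y.
  by apply: probability_integral_gt0 => [|x]; [exact: measurable_tilt2|exact: tilt_gt0].
have Q'c0 B : measurable B -> Q' B = \int[Q]_(y in B) c0 y.
  move=> mB; rewrite Q'E /blahut_step [RHS]integral_mkcond.
  pose gB (p : TX * TY) := (tilt p.1 p.2 * \1_B p.2)%:E.
  (* The set [B] enters as an indicator so that Tonelli can exchange the two integrals. *)
  transitivity (\int[PX]_x \int[Q]_y gB (x, y)).
    apply: eq_integral => x _; rewrite integral_mkcond; apply: eq_integral => y _.
    by rewrite patchE /gB indicE /=; case: ifPn => _ /=; rewrite ?mulr1 ?mulr0.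
  rewrite (@fubini_tonelli _ _ _ _ _ PX Q gB).
  - apply: eq_integral => y _; rewrite patchE; case: ifPn => yB.
      by apply: eq_integral => x _; rewrite /gB indicE /= yB mulr1.
    by apply: integral0_eq => x _; rewrite /gB indicE /= (negbTE yB) mulr0.
  - apply/measurable_EFinP/measurable_funM; first exact: measurable_tilt.
    exact: (measurableT_comp (measurable_indic mB)).
  - by move=> p; rewrite lee_fin mulr_ge0// tilt_ge0.
pose c y := if (0 < fine (c0 y))%R then fine (c0 y) else 1%R.
have mc : measurable_fun [set: TY] c.
  have mf : measurable_fun [set: TY] (fine \o c0) by exact: measurableT_comp.
  by apply: measurable_fun_ifT => //; exact: measurable_fun_ltr.
have c_gt0 y : (0 < c y)%R by rewrite /c; case: ifPn.
(* The integral of [c0] is the total mass of [Q'], so [c0] is finite almost everywhere. *)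
have c0c : {ae Q, forall y, c0 y = (c y)%:E}.
  have : Q.-integrable [set: TY] c0.
    apply/integrableP; split => //.
    under eq_integral do rewrite gee0_abs//.
    by rewrite -Q'c0// [X in X < _]probability_setT ltry.
  move=> /(integrable_ae measurableT); apply: filterS => y /(_ I) c0fin.
  rewrite /c ifT ?fineK//.
  by rewrite fine_gt0// c0_gt0 ltey_eq c0fin.
exists c; split => //; split => // [y|B mB]; first exact: ltW.
rewrite Q'c0//; apply: ae_eq_integral => //.
- exact: measurable_funTS.
- exact/measurable_funTS/measurable_EFinP.
- by apply: filterS c0c => y ->.
Qed.

(** * Monotonicity: the tilted kernel against the old and new output laws *)

Section step.
Variables (K : R.-pker TX ~> TY) (Q' : probability TY R) (c : TY -> R).
Hypothesis KE : forall x, K x = (fun B => \int[Q]_(y in B) (tilt x y)%:E)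
  :> (set TY -> \bar R).
Hypothesis KQ' : marginal PX K = Q'.
Hypothesis Q'c : is_density Q' Q c.
Hypothesis c_gt0 : forall y, (0 < c y)%R.

Let c_ge0 y : (0 <= c y)%R. Proof. exact: ltW. Qed.

Let mc : measurable_fun [set: TY] c. Proof. by case: Q'c. Qed.

Lemma is_density_blahut_kernel x (P : probability TY R) :
  P = K x :> (set TY -> \bar R) -> is_density P Q (tilt x).
Proof.
move=> ->; split; [exact: measurable_tilt1|exact: tilt_ge0|].
by move=> A mA; rewrite KE.
Qed.

(** This is the equality case of the variational bound: with [t = tilt x y], [phi t + lam * dist x y
    * t + t = - ln (Z x) * t + 1], and both [t] and [1] integrate to one. *)
Lemma relent_blahut_kernel x :
  relent (K x) Q + \int[K x]_y (lam * dist x y)%:E = (- ln (Z x))%:E.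
Proof.
have [P PE] := pker_probability K x.
have Pt := is_density_blahut_kernel PE; rewrite -PE (relentE Pt).
have ld0 y : (0 <= lam * dist x y)%R by rewrite mulr_ge0.
have mld := measurable_lam_dist x; have mt := measurable_tilt1 x.
rewrite (is_density_integral_EFin Pt)//.
rewrite -[LHS](@addeK R 1)// -[RHS](@addeK R 1)//; congr (_ - _).
rewrite -[X in _ + X = _](integral_tilt x).
rewrite -[X in X%:E + _]mulr1 EFinM -[X in _ * X + _](integral_tilt x).
rewrite -[X in _ = _ + X](probability_integral_cst Q 1) -ge0_integralZl//; last first.
- by rewrite lee_fin oppr_ln_partfun_ge0.
- by move=> y _; rewrite lee_fin tilt_ge0.
- exact/measurable_EFinP.
have mphi : measurable_fun [set: TY] (fun y => phi (tilt x y)).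
  exact: measurableT_comp (@measurable_phi R) mt.
have mlt : measurable_fun [set: TY] (fun y => lam * dist x y * tilt x y)%R.
  exact: measurable_funM.
have p0 y : (0 <= phi (tilt x y))%R by rewrite phi_ge0// tilt_ge0.
have lt0 y : (0 <= lam * dist x y * tilt x y)%R by rewrite mulr_ge0// tilt_ge0.
under [in RHS]eq_integral do rewrite -EFinM.
rewrite -!ge0_integralD_EFin//.
- apply: eq_integral => y _; congr (_%:E).
  rewrite /phi ln_tilt; ring.
- exact: measurable_funM.
- by move=> y; rewrite mulr_ge0 ?oppr_ln_partfun_ge0 ?tilt_ge0.
- exact: measurable_funD.
- by move=> y; rewrite addr_ge0.
- by move=> y; exact: tilt_ge0.
Qed.

(** The density of this kernel is jointly measurable, so Tonelli applies and genuine additivity of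
    the integral becomes available. *)
Lemma measurable_relent_blahut_kernel :
  measurable_fun [set: TX] (fun x => relent (K x) Q).
Proof.
pose g (p : TX * TY) := (phi (tilt p.1 p.2))%:E.
rewrite (_ : (fun _ => _) = fubini_F Q g); last first.
  apply/funext => x; have [P PE] := pker_probability K x.
  by rewrite -PE (relentE (is_density_blahut_kernel PE)).
apply: measurable_fun_fubini_tonelli_F.
- by apply/measurable_EFinP; exact: measurableT_comp (@measurable_phi R) measurable_tilt.
- by move=> p; rewrite lee_fin phi_ge0// tilt_ge0.
Qed.

Lemma measurable_relent_blahut_step :
  measurable_fun [set: TX] (fun x => relent (K x) Q').
Proof.
pose g (p : TX * TY) := (phi (tilt p.1 p.2 / c p.2))%:E.
rewrite (_ : (fun _ => _) = fubini_F Q' g); last first.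
  apply/funext => x; have [P PE] := pker_probability K x.
  by rewrite -PE (relentE (is_density_div (is_density_blahut_kernel PE) Q'c c_gt0)).
apply: measurable_fun_fubini_tonelli_F.
- apply/measurable_EFinP; apply: measurableT_comp (@measurable_phi R) _.
  apply: measurable_funM; first exact: measurable_tilt.
  apply: measurable_fun_gt0_inv => //.
  exact: measurableT_comp.
- by move=> p; rewrite lee_fin phi_ge0// divr_ge0// tilt_ge0.
Qed.

Let relentK_ge0 (P : probability TY R) x : 0 <= relent (K x) P.
Proof. by have [P' <-] := pker_probability K x; exact: relent_ge0. Qed.

Lemma condrelent_blahut_kernel :
  condrelent PX K Q + lam%:E * exp_distortion PX dist K = free_energy.
Proof.
rewrite scale_exp_distortion /condrelent -ge0_integralD//.
- by apply: eq_integral => x _; rewrite relent_blahut_kernel.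
- exact: measurable_relent_blahut_kernel.
- by move=> x _; apply: integral_ge0 => y _; rewrite lee_fin mulr_ge0.
- exact: measurable_fun_pker_distortion.
Qed.

(** Averaging the chain rule over [x] shows that the right side exceeds the left by E_{Q'}[ln c] =
    D(Q'||Q) >= 0. *)
Lemma condrelent_blahut_kernel_le : condrelent PX K Q' <= condrelent PX K Q.
Proof.
have mln (s : R -> R) : measurable_fun [set: R] s ->
    measurable_fun [set: TY] (fun y => (s (c y))%:E).
  by move=> ms; apply/measurable_EFinP; exact: measurableT_comp ms mc.
have mp := mln _ (@measurable_lnpos R).
have mn := mln _ (@measurable_lnneg R).
have p0 y : 0 <= (lnpos (c y))%:E by rewrite lee_fin lnpos_ge0.
have n0 y : 0 <= (lnneg (c y))%:E by rewrite lee_fin lnneg_ge0.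
have mK g : (forall y, 0 <= g y) -> measurable_fun [set: TY] g ->
    measurable_fun [set: TX] (fun x => \int[K x]_y g y).
  by move=> g0 mg; apply: measurable_fun_integral_kernel => // U mU;
    exact: measurable_kernel.
have I0 g x : (forall y, 0 <= g y) -> 0 <= \int[K x]_y g y.
  by move=> g0; exact: integral_ge0.
have chain : condrelent PX K Q' + \int[Q']_y (lnpos (c y))%:E =
             condrelent PX K Q + \int[Q']_y (lnneg (c y))%:E.
  have IQ' g : (forall y, 0 <= g y) -> measurable_fun [set: TY] g ->
      \int[Q']_y g y = \int[PX]_x \int[K x]_y g y.
    by move=> g0 mg; rewrite -KQ' integral_marginal.
  rewrite (IQ' _ p0 mp) (IQ' _ n0 mn) /condrelent.
  rewrite -(ge0_integralD PX measurableT (fun x _ => relentK_ge0 Q' x)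
    measurable_relent_blahut_step (fun x _ => I0 _ x p0) (mK _ p0 mp)).
  rewrite -(ge0_integralD PX measurableT (fun x _ => relentK_ge0 Q x)
    measurable_relent_blahut_kernel (fun x _ => I0 _ x n0) (mK _ n0 mn)).
  apply: eq_integral => x _; have [P PE] := pker_probability K x.
  by rewrite -PE; exact: relent_chain_rule (is_density_blahut_kernel PE) Q'c c_gt0.
(* Under [Q] the integrand is c ln^- c, which is at most one because [phi c] is nonnegative;
   finiteness permits the final cancellation. *)
have nfin : \int[Q']_y (lnneg (c y))%:E \is a fin_num.
  rewrite ge0_fin_numE; last exact: integral_ge0.
  rewrite (is_density_integral_EFin Q'c); last 2 first.
  - exact: measurableT_comp (@measurable_lnneg R) mc.
  - by move=> y; exact: lnneg_ge0.
  apply: (@le_lt_trans _ _ 1); last exact: ltry.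
  rewrite -[leRHS](probability_integral_cst Q 1); apply: ge0_le_integral => //.
  - by move=> y _; rewrite lee_fin mulr_ge0// lnneg_ge0.
  - apply/measurable_EFinP/measurable_funM => //.
    exact: measurableT_comp (@measurable_lnneg R) mc.
  - move=> y _; rewrite lee_fin /lnneg.
    have := phi_ge0 (c_ge0 y); have := c_ge0 y; rewrite /phi.
    by case: (leP (- ln (c y)) 0)%R; lra.
have le_np : \int[Q']_y (lnneg (c y))%:E <= \int[Q']_y (lnpos (c y))%:E.
  (* The chain rule with [P = Q'] identifies E_{Q'}[ln c] with D(Q'||Q). *)
  have := relent_chain_rule Q'c Q'c c_gt0; rewrite relent_refl add0e => ->.
  by rewrite leeDr// relent_ge0.
by rewrite -(leeD2rE _ _ nfin) -chain leeD2l.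
Qed.

End step.

(** * Comparison with the optimal kernel *)

Section optimal_kernel.
Variables (Kstar : R.-pker TX ~> TY) (Ps Q' : probability TY R).
Variables (h c : TY -> R).
Hypothesis PsE : Ps = marginal PX Kstar :> (set TY -> \bar R).
Hypothesis Psh : is_density Ps Q h.
Hypothesis Q'c : is_density Q' Q c.
Hypothesis c_gt0 : forall y, (0 < c y)%R.
Hypothesis c_ae : {ae Q, forall y, \int[PX]_x (tilt x y)%:E = (c y)%:E}.

Let c_ge0 y : (0 <= c y)%R. Proof. exact: ltW. Qed.

Let mc : measurable_fun [set: TY] c. Proof. by case: Q'c. Qed.

Let ratio_ge0 x y : (0 <= tilt x y / c y)%R.
Proof. by rewrite divr_ge0// tilt_ge0. Qed.

Let mratio : measurable_fun [set: TX * TY] (fun p => tilt p.1 p.2 / c p.2)%R.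
Proof.
apply: measurable_funM; first exact: measurable_tilt.
by apply: measurable_fun_gt0_inv => //; exact: measurableT_comp.
Qed.

(** After Tonelli the inner average of the tilts is [c], [Q]-almost everywhere; this suffices
    because [Ps] has density [h] with respect to [Q]. *)
Let integral_ratio : \int[PX]_x \int[Ps]_y (tilt x y / c y)%:E = 1.
Proof.
pose g (p : TX * TY) := (tilt p.1 p.2 / c p.2)%:E.
have mg : measurable_fun [set: TX * TY] g by exact/measurable_EFinP.
have g0 p : 0 <= g p by rewrite lee_fin.
rewrite (@fubini_tonelli _ _ _ _ _ PX Ps g mg g0).
have [mh h0 _] := Psh.
rewrite (is_density_integral Psh); last 2 first.
- exact: (@measurable_fun_fubini_tonelli_G _ _ _ _ _ PX g).
- by move=> y; apply: integral_ge0.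
rewrite -(is_density_integral1 Psh); apply: ae_eq_integral => //.
- apply: emeasurable_funM; last exact/measurable_EFinP.
  exact: (@measurable_fun_fubini_tonelli_G _ _ _ _ _ PX g).
- exact/measurable_EFinP.
- apply: filterS c_ae => y cy _ /=; rewrite /g /=.
  under eq_integral do rewrite EFinM.
  rewrite ge0_integralZr//.
  + have cN : c y != 0%R by rewrite gt_eqF.
    by rewrite cy -EFinM mulfV// mul1r.
  + by apply/measurable_EFinP; exact: measurable_tilt2.
  + by move=> x _; rewrite lee_fin tilt_ge0.
  + by rewrite lee_fin invr_ge0.
Qed.

(* The test function at [x] is [y |-> ln (tilt x y / c y)], the log-density with
   respect to [Q'] of the next Blahut kernel; its exponential has mean one under
   [PX * Ps]. *)
Lemma free_energy_optimal_kernel :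
  free_energy + \int[Ps]_y (lnneg (c y))%:E <=
  mutinf PX Kstar + lam%:E * exp_distortion PX dist Kstar
    + \int[Ps]_y (lnpos (c y))%:E.
Proof.
have mln (s : R -> R) : measurable_fun [set: R] s ->
    measurable_fun [set: TY] (fun y => s (c y)).
  by move=> ms; exact: measurableT_comp ms mc.
have mp := mln _ (@measurable_lnpos R).
have mn := mln _ (@measurable_lnneg R).
have mpE : measurable_fun [set: TY] (fun y => (lnpos (c y))%:E).
  exact/measurable_EFinP.
have mnE : measurable_fun [set: TY] (fun y => (lnneg (c y))%:E).
  exact/measurable_EFinP.
have p0 y : 0 <= (lnpos (c y))%:E by rewrite lee_fin lnpos_ge0.
have n0 y : 0 <= (lnneg (c y))%:E by rewrite lee_fin lnneg_ge0.
have IPs g : (forall y, 0 <= g y) -> measurable_fun [set: TY] g ->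
    \int[Ps]_y g y = \int[PX]_x \int[Kstar x]_y g y.
  by move=> g0 mg; rewrite PsE integral_marginal.
have mK g : (forall y, 0 <= g y) -> measurable_fun [set: TY] g ->
    measurable_fun [set: TX] (fun x => \int[Kstar x]_y g y).
  by move=> g0 mg; apply: measurable_fun_integral_kernel => // U mU;
    exact: measurable_kernel.
have I0 g x : (forall y, 0 <= g y) -> 0 <= \int[Kstar x]_y g y.
  by move=> g0; exact: integral_ge0.
have ld0 x y : (0 <= lam * dist x y)%R by rewrite mulr_ge0.
have ldE0 x y : 0 <= (lam * dist x y)%:E by rewrite lee_fin.
(* The added one is the constant of the variational bound, written on the right as the mean of
   [tilt x y / c y]. *)
rewrite -(@leeD2rE _ 1)// -[X in _ <= _ + X]integral_ratio.
rewrite scale_exp_distortion (IPs _ p0 mpE) (IPs _ n0 mnE) /mutinf -PsE.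
rewrite -[X in _ + _ + X <= _](probability_integral_cst PX 1) /free_energy.
have mZ : measurable_fun [set: TX] (fun x => (- ln (Z x))%:E).
  exact/measurable_EFinP/measurable_ln_partfun.
have Z0 x : 0 <= (- ln (Z x))%:E by rewrite lee_fin oppr_ln_partfun_ge0.
have mr : measurable_fun [set: TX] (fun x => \int[Ps]_y (tilt x y / c y)%:E).
  pose g (p : TX * TY) := (tilt p.1 p.2 / c p.2)%:E.
  apply: (@measurable_fun_fubini_tonelli_F _ _ _ _ _ Ps g).
  - exact/measurable_EFinP.
  - by move=> p; rewrite lee_fin.
have r0 x : 0 <= \int[Ps]_y (tilt x y / c y)%:E.
  by apply: integral_ge0 => y _; rewrite lee_fin.
have mD := measurable_fun_pker_distortion Kstar.
have nx0 x : 0 <= \int[Kstar x]_y (lnneg (c y))%:E by exact: I0.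
have px0 x : 0 <= \int[Kstar x]_y (lnpos (c y))%:E by exact: I0.
have dx0 x : 0 <= \int[Kstar x]_y (lam * dist x y)%:E by exact: I0.
have mZn := emeasurable_funD mZ (mK _ n0 mnE).
have mDp := emeasurable_funD mD (mK _ p0 mpE).
rewrite -(ge0_integralD PX measurableT (fun x _ => Z0 x) mZ
  (fun x _ => nx0 x) (mK _ n0 mnE)).
rewrite -(ge0_integralD PX measurableT
  (fun x _ => adde_ge0 (Z0 x) (nx0 x)) mZn
  (fun _ _ => @lee01 R) (@measurable_cst _ _ _ _ _ (1 : \bar R))).
rewrite -2!addeA [X in _ <= _ + X]addeA.
rewrite -(ge0_integralD PX measurableT (fun x _ => dx0 x) mD
  (fun x _ => px0 x) (mK _ p0 mpE)).
rewrite -(ge0_integralD PX measurableT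
  (fun x _ => adde_ge0 (dx0 x) (px0 x)) mDp (fun x _ => r0 x) mr).
(* The relative entropies of [Kstar x] form the first summand, whose measurability is unknown; all
   other terms on the right are gathered in the measurable second one. *)
apply: lower_integralD_ge.
- by move=> x; have [P <-] := pker_probability Kstar x; exact: relent_ge0.
- by move=> x; exact: adde_ge0 (adde_ge0 (dx0 x) (px0 x)) (r0 x).
- by move=> x; exact: adde_ge0 (adde_ge0 (Z0 x) (nx0 x)) _.
- exact: emeasurable_funD.
- exact: emeasurable_funD.
move=> x; have [P PE] := pker_probability Kstar x; rewrite -PE.
have mld := measurable_lam_dist x.
have := @relent_variational _ _ _ P Ps
  (fun y => lam * dist x y + lnpos (c y))%R
  (fun y => - ln (Z x) + lnneg (c y))%R (fun y => tilt x y / c y)%R.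
have [pr0 nr0] := ((fun y => lnpos_ge0 (c y)), (fun y => lnneg_ge0 (c y))).
have zr0 := oppr_ln_partfun_ge0 x.
rewrite !ge0_integralD_EFin ?probability_integral_cst//.
rewrite [X in _ <= _ + X]addeC; apply.
- exact: measurable_funD.
- exact: measurable_funD.
- exact: (measurableT_comp mratio (pair1_measurable x)).
- by move=> y; rewrite addr_ge0// lnpos_ge0.
- by move=> y; rewrite addr_ge0 ?oppr_ln_partfun_ge0 ?lnneg_ge0.
- move=> y; rewrite [X in expR X](_ : _ = ln (tilt x y / c y)).
    by rewrite lnK// posrE; exact: divr_gt0 (tilt_gt0 x y) (c_gt0 y).
  by rewrite ln_div ?posrE ?tilt_gt0// ln_tilt -(lnposBneg (c y)); ring.
Qed.

(** The sum of [free_energy_optimal_kernel] and the chain rule, after cancelling E_{Ps}[ln^+ c] and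
    E_{Ps}[ln^- c]. The first is finite by [relent_lnpos_le], the second because the right side of
    the former inequality is then finite. *)
Lemma relent_blahut_step_le :
  mutinf PX Kstar + lam%:E * exp_distortion PX dist Kstar < +oo ->
  relent Ps Q < +oo ->
  relent Ps Q' + free_energy <=
  mutinf PX Kstar + lam%:E * exp_distortion PX dist Kstar + relent Ps Q.
Proof.
have := free_energy_optimal_kernel.
have := relent_chain_rule Psh Q'c c_gt0.
have := relent_lnpos_le Psh Q'c c_gt0.
have : 0 <= \int[Ps]_y (lnneg (c y))%:E.
  by apply: integral_ge0 => y _; rewrite lee_fin lnneg_ge0.
have : 0 <= \int[Ps]_y (lnpos (c y))%:E.
  by apply: integral_ge0 => y _; rewrite lee_fin lnpos_ge0.
have : 0 <= free_energy.
  by apply: integral_ge0 => x _; rewrite lee_fin oppr_ln_partfun_ge0.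
have := relent_ge0 Ps Q; have := relent_ge0 Ps Q'.
move: (relent Ps Q) (relent Ps Q') free_energy => D D' G.
move: (mutinf PX Kstar + lam%:E * exp_distortion PX dist Kstar) => F.
move: (\int[Ps]_y (lnpos (c y))%:E) (\int[Ps]_y (lnneg (c y))%:E) => A B.
move=> D'0 D0 G0 A0 B0 AD chain GF Foo Doo.
case: D => [D| |]// in D0 AD chain Doo *.
case: A => [A| |]// in A0 AD chain GF *.
case: F => [F| |]// in GF Foo *.
- case: B => [B| |]// in B0 chain GF *.
  + case: D' => [D'| |]// in D'0 chain *; case: G => [G| |]// in G0 GF *.
    move: chain GF; rewrite -!EFinD !lee_fin => -[chain] GF; lra.
  + by move: GF; rewrite addey//; case: G G0.
- move: GF; rewrite addNye leeNy_eq => /eqP GB.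
  by have := adde_ge0 G0 B0; rewrite GB.
Qed.

End optimal_kernel.

End partition_function.
End blahut_step.

(** * Summation of the one-step inequality *)

(* Telescoping the last hypothesis bounds the sum of [f 0], ..., [f k], and each
   of these terms is at least [f k]. *)
Lemma telescope_rate (R : realType) (F : \bar R) (f D : nat -> \bar R) :
    F \is a fin_num -> D 0%N < +oo -> (forall k, 0 <= D k) ->
    (forall k, F <= f k) -> (forall k, f k.+1 <= f k) ->
    (forall k, D k < +oo -> D k.+1 + f k <= F + D k) ->
  forall k, f k <= F + D 0%N * (k.+1%:R^-1)%:E.
Proof.
case: F => [F| |]// _ D0oo D0 Ff f_dec step.
have D0fin : D 0%N \is a fin_num by rewrite ge0_fin_numE.
(* Finiteness of [D k.+1] is carried through the induction, since the one-step inequality is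
   available only from a finite [D k]. *)
have sum k : exists Dk fk : R, [/\ D k.+1 = Dk%:E, f k = fk%:E &
    (Dk + k.+1%:R * fk <= k.+1%:R * F + fine (D 0%N))%R].
  have stepR i (Di : R) : D i = Di%:E -> exists Dk fk : R,
      [/\ D i.+1 = Dk%:E, f i = fk%:E & (Dk + fk <= F + Di)%R].
    move=> DiE; have := step i; rewrite DiE => /(_ (ltry _)).
    have := D0 i.+1; have := Ff i.
    case: (f i) => [fi| |]//; case: (D i.+1) => [Dk| |]// _ _.
    by rewrite -!EFinD lee_fin => h; exists Dk, fi.
  elim: k => [|k [Dk [fk [DkE fkE IH]]]].
    have [Dk [fk [DkE fkE h]]] := stepR 0%N _ (esym (fineK D0fin)).
    by exists Dk, fk; split => //; rewrite !mul1r.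
  have [Dk1 [fk1 [Dk1E fk1E h]]] := stepR _ _ DkE.
  exists Dk1, fk1; split => //.
  have : (k.+1%:R * fk1 <= k.+1%:R * fk)%R.
    by rewrite ler_wpM2l// -lee_fin -fkE -fk1E.
  by rewrite -(natr1 k.+1) !mulrDl !mul1r; lra.
move=> k; have [Dk [fk [DkE -> h]]] := sum k.
have Dk0 : (0 <= Dk)%R by rewrite -lee_fin -DkE.
have k0 : (0 < k.+1%:R :> R)%R by rewrite ltr0n.
rewrite -(fineK D0fin) -EFinM -EFinD lee_fin -lerBlDl ler_pdivlMr// mulrBl.
lra.
Qed.

(** * The iterated scheme *)

Section blahut_iteration.
Context (R : realType) (dx dy : measure_display).
Context (TX : measurableType dx) (TY : measurableType dy).
Variables (PX : probability TX R) (dist : TX -> TY -> R) (lam : R).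
Variable PY0 : probability TY R.
Hypothesis mdist : measurable_fun [set: TX * TY] (fun p => dist p.1 p.2).
Hypothesis dist_ge0 : forall x y, (0 <= dist x y)%R.
Hypothesis lam_ge0 : (0 <= lam)%R.

Lemma blahut_step_probability (Q : probability TY R) :
  exists Q' : probability TY R,
    Q' = blahut_step PX dist lam Q :> (set TY -> \bar R).
Proof.
have [K [_ <-]] := blahut_kernel PX mdist dist_ge0 lam_ge0 Q.
exact: marginal_probability.
Qed.

Lemma blahut_probability k : exists Q : probability TY R,
  Q = blahut PX dist lam PY0 k :> (set TY -> \bar R).
Proof.
elim: k => [|k [Q QE]]; first by exists PY0.
by have [Q' Q'E] := blahut_step_probability Q; exists Q'; rewrite Q'E QE.
Qed.

(** The tilted kernel attains the lower bound of [free_energy_le]. The index shifts because F_{k+1}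
    is defined from the output law of index k. *)
Lemma Fk_free_energy k (Q : probability TY R) :
  Q = blahut PX dist lam PY0 k :> (set TY -> \bar R) ->
  Fk PX dist lam PY0 k.+1 = free_energy PX dist lam Q.
Proof.
move=> QE; apply/eqP; rewrite eq_le; apply/andP; split.
- have [K [KE _]] := blahut_kernel PX mdist dist_ge0 lam_ge0 Q.
  rewrite -(condrelent_blahut_kernel PX mdist dist_ge0 lam_ge0 KE) QE.
  by apply: ereal_inf_lbound; exists K.
- by apply: le_ereal_inf_tmp => _ [K _ <-] /=; rewrite -QE; exact: free_energy_le.
Qed.

(** The tilted kernel of [Q] competes in both infima at the same cost, as its own marginal is the
    next output law; that cost is at most the free energy. *)
Lemma free_energy_ge k (Q : probability TY R) :
  Q = blahut PX dist lam PY0 k :> (set TY -> \bar R) ->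
  Fk PX dist lam PY0 k.+2 <= free_energy PX dist lam Q /\
  RDF PX dist lam <= free_energy PX dist lam Q.
Proof.
move=> QE; have [K [KE KQ]] := blahut_kernel PX mdist dist_ge0 lam_ge0 Q.
have [Q' Q'E] := blahut_step_probability Q.
have [c [Q'c c_gt0 _]] := blahut_density mdist dist_ge0 lam_ge0 Q'E.
have KQ' : marginal PX K = Q' by rewrite KQ Q'E.
have le_fe : condrelent PX K Q' + lam%:E * exp_distortion PX dist K <=
    free_energy PX dist lam Q.
  rewrite -(condrelent_blahut_kernel PX mdist dist_ge0 lam_ge0 KE).
  by rewrite leeD2r// (condrelent_blahut_kernel_le mdist dist_ge0 lam_ge0 KE KQ' Q'c).
split; apply: le_trans le_fe; apply: ereal_inf_lbound;
  (exists K; first by []).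
- by rewrite /= -QE Q'E.
- by rewrite /mutinf KQ'.
Qed.

Lemma RDF_le_Fk k : RDF PX dist lam <= Fk PX dist lam PY0 k.+1.
Proof.
have [Q QE] := blahut_probability k.
by rewrite (Fk_free_energy QE); case: (free_energy_ge QE).
Qed.

Lemma Fk_nonincreasing k : Fk PX dist lam PY0 k.+2 <= Fk PX dist lam PY0 k.+1.
Proof.
have [Q QE] := blahut_probability k.
by rewrite (Fk_free_energy QE); case: (free_energy_ge QE).
Qed.

Variable Kstar : R.-pker TX ~> TY.
Hypothesis Kstar_opt :
  mutinf PX Kstar + lam%:E * exp_distortion PX dist Kstar = RDF PX dist lam.
Hypothesis relent_lty : relent (marginal PX Kstar) PY0 < +oo.
Hypothesis RDF_lty : RDF PX dist lam < +oo.

Local Notation D k := (relent (marginal PX Kstar) (blahut PX dist lam PY0 k)).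

Lemma relent_blahut_le k : D k < +oo ->
  D k.+1 + Fk PX dist lam PY0 k.+1 <= RDF PX dist lam + D k.
Proof.
have [Ps PsE] := marginal_probability PX Kstar.
have [Q QE] := blahut_probability k.
have [Q' Q'E] := blahut_step_probability Q.
have [c [Q'c c_gt0 c_ae]] := blahut_density mdist dist_ge0 lam_ge0 Q'E.
rewrite (Fk_free_energy QE) /= -QE -Q'E -PsE -Kstar_opt => Doo.
have [h Psh] := relent_lty_density Doo.
apply: (relent_blahut_step_le mdist dist_ge0 lam_ge0 PsE Psh Q'c c_gt0 c_ae) => //.
by rewrite Kstar_opt.
Qed.

Lemma relent_blahut_ge0 k : 0 <= D k.
Proof.
have [Ps <-] := marginal_probability PX Kstar.
by have [Q <-] := blahut_probability k; exact: relent_ge0.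
Qed.

Lemma RDF_fin_num : RDF PX dist lam \is a fin_num.
Proof.
rewrite ge0_fin_numE//; apply: le_ereal_inf_tmp => _ [K _ <-] /=.
have [P PE] := marginal_probability PX K.
rewrite scale_exp_distortion// adde_ge0//; apply: integral_ge0 => x _.
- rewrite -PE; have [P' <-] := pker_probability K x; exact: relent_ge0.
- by apply: integral_ge0 => y _; rewrite lee_fin mulr_ge0.
Qed.

Lemma Fk_rate k : Fk PX dist lam PY0 k.+1 <=
  RDF PX dist lam + D 0 * (k.+1%:R^-1)%:E.
Proof.
apply: (telescope_rate (D := fun k => D k)
  (f := fun k => Fk PX dist lam PY0 k.+1)).
- exact: RDF_fin_num.
- exact: relent_lty.
- exact: relent_blahut_ge0.
- exact: RDF_le_Fk.
- exact: Fk_nonincreasing.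
- exact: relent_blahut_le.
Qed.

End blahut_iteration.

Theorem theorem6 (R : realType) (dx dy : measure_display)
  (TX : measurableType dx) (TY : measurableType dy)
  (PX : probability TX R) (dist : TX -> TY -> R) (lam : R)
  (Kstar : R.-pker TX ~> TY) (PY0 : probability TY R) :
  (forall x : TX, measurable [set x]) ->
  (forall y : TY, measurable [set y]) ->
  measurable_fun [set: TX * TY] (fun p => dist p.1 p.2) ->
  (forall x y, 0 <= dist x y)%R ->
  (0 < lam)%R ->
  mutinf PX Kstar + lam%:E * exp_distortion PX dist Kstar = RDF PX dist lam ->
  relent (marginal PX Kstar) PY0 < +oo ->
  [/\ (forall k, (1 <= k)%N -> Fk PX dist lam PY0 k.+1 <= Fk PX dist lam PY0 k),
      Fk PX dist lam PY0 k @[k --> \oo] --> RDF PX dist lam &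
      (forall k, (1 <= k)%N ->
         Fk PX dist lam PY0 k
           <= RDF PX dist lam + relent (marginal PX Kstar) PY0 * (k%:R^-1)%:E)].
Proof.
move=> _ _ mdist dist_ge0 /ltW lam_ge0 Kstar_opt Doo.
have RDF_le := RDF_le_Fk PX PY0 mdist dist_ge0 lam_ge0.
have D_ge0 : 0 <= relent (marginal PX Kstar) PY0.
  by have [Ps <-] := marginal_probability PX Kstar; exact: relent_ge0.
have rate k : Fk PX dist lam PY0 k.+1 <= RDF PX dist lam +
    relent (marginal PX Kstar) PY0 * (k.+1%:R^-1)%:E.
  (* The attained infimum may be infinite, in which case the bound holds because its right side is
     [+oo]. *)
  have [RDFoo|] := ltP (RDF PX dist lam) +oo.
    exact: Fk_rate.
  rewrite leye_eq => /eqP ->; rewrite addye ?leey// gt_eqF//.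
  by rewrite (@lt_le_trans _ _ 0)// mule_ge0// lee_fin invr_ge0.
split.
- case=> [k0|k _]; first by discriminate k0.
  exact: (Fk_nonincreasing PX PY0 mdist dist_ge0 lam_ge0 k).
(* The bounds start at index one, so the sequence is shifted before being squeezed. *)
- rewrite -(cvg_shiftS (fun k => Fk PX dist lam PY0 k)).
  apply: (@squeeze_cvge _ _ _ _ (fun=> RDF PX dist lam) _
    (fun k => RDF PX dist lam + relent (marginal PX Kstar) PY0 * (k.+1%:R^-1)%:E)).
  + by apply: nearW => k; apply/andP; split; [exact: RDF_le|exact: rate].
  + exact: cvg_cst.
  + rewrite -[X in _ --> X]adde0 -[X in _ --> _ + X](mule0 (relent (marginal PX Kstar) PY0)).
    (* The second limit is zero, so the sum of limits is defined even for an infinite [RDF]. *)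
    apply: cvgeD; [by rewrite mule0 fin_num_adde_defl|exact: cvg_cst|].
    by apply: cvgeZl; [rewrite ge0_fin_numE|exact: cvge_harmonic].
- case=> [k0|k _]; first by discriminate k0.
  exact: rate.
Qed.
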